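(* Let $\mathcal{H}$ be a separable Hilbert space and $\mathcal{K}$ a finite-dimensional Hilbert space. Let $T\in B(\mathcal{H})$ and $\Lambda_1\in B(\mathcal{H},\mathcal{K})$ be such that $\Lambda=\{\Lambda_1T^{i-1}\in B(\mathcal{H},\mathcal{K}): i\in\mathbb{N}\}$ is a $g$-frame for $\mathcal{H}$ with respect to $\mathcal{K}$. Then $T$ is not compact.
   Context: $\mathbb{N}=\{1,2,3,\dots\}$; $B(\mathcal{H},\mathcal{K})$ denotes the bounded linear operators from $\mathcal{H}$ to $\mathcal{K}$, and $B(\mathcal{H})=B(\mathcal{H},\mathcal{H})$. A family $\Lambda=\{\Lambda_i\in B(\mathcal{H},\mathcal{K}): i\in\mathbb{N}\}$ is a $g$-frame for $\mathcal{H}$ with respect to $\mathcal{K}$ if there are constants $0<A_\Lambda\le B_\Lambda<\infty$ such that $A_\Lambda\|f\|^2\le\sum_{i\in\mathbb{N}}\|\Lambda_i f\|^2\le B_\Lambda\|f\|^2$ for all $f\in\mathcal{H}$.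
   Formalization: The Hilbert space H is additionally assumed infinite-dimensional; without this the statement fails, e.g. for H = K = C, Λ₁ = identity, T = 0, where Λ is a g-frame and T is compact. *)

(* Defs.v *)
From HB Require Import structures.
From mathcomp Require Import all_boot all_order all_algebra sesquilinear.
From mathcomp Require Import all_classical all_reals all_analysis.
From mathcomp Require Import complex.

Set Implicit Arguments.
Unset Strict Implicit.
Unset Printing Implicit Defensive.

Import Order.TTheory GRing.Theory Num.Theory numFieldNormedType.Exports.

Local Open Scope classical_set_scope.
Local Open Scope ring_scope.
Local Open Scope complex_scope.

(* The admissible scalar fields of a Hilbert space, each with its conjugation:
   a Hilbert space may be real or complex. *)
Variant hilbert_scalars (R : realType) : forall F : numFieldType, (F -> F) -> Prop :=
  | real_scalars : @hilbert_scalars R R idfun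
  | complex_scalars : @hilbert_scalars R R[i] (@Num.conj R[i]).

(* [inner] is linear in its first argument and [theta]-linear in its second. *)
HB.mixin Record isHilbert (F : numFieldType) (theta : F -> F) H
    of CompleteNormedModule F H := {
  inner : {dot H for theta};
  innerE : forall x : H, inner x x = `|x| ^+ 2
}.

#[short(type="hilbertType")]
HB.structure Definition Hilbert (F : numFieldType) (theta : F -> F) :=
  {H of CompleteNormedModule F H & isHilbert F theta H}.

Definition separable_space (T : topologicalType) : Prop :=
  exists2 S : set T, countable S & dense S.

Definition finite_dimensional (F : numFieldType) (V : lmodType F) : Prop :=
  exists (n : nat) (e : 'I_n -> V),
    forall x : V, exists c : 'I_n -> F, x = \sum_(i < n) c i *: e i.

(* Membership in B(V, W). *)
Definition bounded_operator (F : numFieldType) (V W : normedModType F)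
    (f : V -> W) : Prop :=
  linear f /\ exists M : F, forall x : V, `|f x| <= M * `|x|.

Definition compact_operator (F : numFieldType) (V W : normedModType F)
    (f : V -> W) : Prop :=
  bounded_operator f /\ precompact (f @` [set x : V | `|x| <= 1]).

(* The family is indexed from 0: [L i] is the (i+1)-st operator.  Norms take
   values in [F]; as [0 < A <= B], the constants [A] and [B] are real. *)
Definition g_frame (F : numFieldType) (H K : normedModType F)
    (L : nat -> H -> K) : Prop :=
  (forall i, bounded_operator (L i)) /\
  exists A B : F, [/\ 0 < A, A <= B &
    forall f : H, exists2 s : F,
      series (fun i => `|L i f| ^+ 2) @ \oo --> s &
      A * `|f| ^+ 2 <= s <= B * `|f| ^+ 2].

(* Main.v *)
From HB Require Import structures.
Require Import Defs.
From mathcomp Require Import all_boot all_order all_algebra.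
From mathcomp Require Import all_classical all_reals all_analysis.
From mathcomp Require Import sesquilinear.

Set Implicit Arguments.
Unset Strict Implicit.
Unset Printing Implicit Defensive.

Import Order.TTheory GRing.Theory Num.Theory numFieldNormedType.Exports.

Local Open Scope classical_set_scope.
Local Open Scope ring_scope.

(** The lower frame bound, with the tail of the series estimated by the upper
    frame bound at [T f], gives [A |f|^2 <= |L1 f|^2 + B |T f|^2].  If [T] were
    compact, the image of the unit ball would be covered by finitely many balls
    of small radius [r] with centres [y_j].  Since [H] is infinite-dimensional
    and [K] is finite-dimensional, some unit vector [f] satisfies [L1 f = 0] and
    [T f] orthogonal to every [y_j]; then [|T f| <= |T f - y_j| < r] for some
    [j], so [A <= B r^2], which fails for small [r]. *)

(** Independence is tested on images in ['rV[F]_n], so independent families have at most [n]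
    members. A longest one spans: [phi x] depends on its images, and injectivity pulls the relation
    back to [V]. *)
Lemma finite_dimensional_of_linear_inj (F : numFieldType) (V : lmodType F)
    (n : nat) (phi : V -> 'rV[F]_n) :
  linear phi -> (forall x, phi x = 0 -> x = 0) -> finite_dimensional V.
Proof.
move=> phi_lin phi_inj.
pose phiL : {linear V -> 'rV[F]_n} :=
  HB.pack phi (GRing.isLinear.Build _ _ _ _ phi phi_lin).
pose mx r (e : 'I_r -> V) := \matrix_i phi (e i).
pose P r := `[< exists e : 'I_r -> V, row_free (mx r e) >].
have P0 : exists r, P r.
  exists 0%N; apply/asboolP; exists (fun=> 0).
  by rewrite /row_free -leqn0 rank_leq_row.
have Pn r : P r -> (r <= n)%N.
  by move=> /asboolP[e /eqP <-]; exact: rank_leq_col.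
case: (ex_maxnP P0 Pn) => r /asboolP[e e_free] r_max.
exists r, e => x.
suff /submxP[D phixE] : (phi x <= mx r e)%MS.
  exists (fun i => D 0 i); apply/eqP; rewrite -subr_eq0; apply/eqP/phi_inj.
  rewrite -[phi _]/(phiL _) linearB linear_sum [phiL x]phixE mulmx_sum_row.
  apply/eqP; rewrite subr_eq0; apply/eqP/eq_bigr => i _.
  by rewrite linearZ rowK.
have r1_not_free : ~~ P r.+1 by apply/negP => /r_max; rewrite ltnn.
apply: contraNT r1_not_free => x_notin; apply/asboolP.
exists (fun i : 'I_(1 + r) => match fintype.split i with inl _ => x | inr j => e j end).
set M := mx _ _.
have -> : M = col_mx (phi x) (mx r e).
  apply/matrixP => i j; rewrite !mxE.
  by case: (fintype.split _) => k; rewrite ?mxE // (ord1 k).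
have eS : (mx r e <= col_mx (phi x) (mx r e))%MS by rewrite -addsmxE addsmxSr.
rewrite /row_free eqn_leq rank_leq_row /=.
rewrite -{1}(eqP e_free) (ltn_leqif (mxrank_leqif_sup eS)).
by rewrite -addsmxE addsmx_sub negb_and x_notin.
Qed.

Section InnerProduct.
Context {F : numFieldType} {theta : F -> F} {H : hilbertType theta}.
Implicit Types x y z : H.

Lemma innerC x y : inner x y = theta (inner y x).
Proof. by have := hermitian_subproof (s := @inner F theta H) x y; rewrite mul1r. Qed.

Lemma innerDl x y z : inner (x + y) z = inner x z + inner y z.
Proof. exact: (linearDl (@inner F theta H)). Qed.

Lemma innerBl x y z : inner (x - y) z = inner x z - inner y z.
Proof. exact: (linearBl (@inner F theta H)). Qed.

Lemma innerZl a x y : inner (a *: x) y = a * inner x y.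
Proof. exact: (linearZl_LR (@inner F theta H)). Qed.

Lemma innerDr x y z : inner x (y + z) = inner x y + inner x z.
Proof. exact: (linearDr (@inner F theta H)). Qed.

Lemma innerBr x y z : inner x (y - z) = inner x y - inner x z.
Proof. exact: (linearBr (@inner F theta H)). Qed.

Lemma innerZr a x y : inner x (a *: y) = theta a * inner x y.
Proof. exact: (linearZr_LR (@inner F theta H)). Qed.

Lemma inner0l x : inner 0 x = 0.
Proof. exact: (linear0l (@inner F theta H)). Qed.

Lemma inner0r x : inner x 0 = 0.
Proof. exact: (linear0r (@inner F theta H)). Qed.

Lemma inner_sym0 x y : inner x y = 0 -> inner y x = 0.
(* [theta 0 = 0] comes from the symmetry [innerC] at [inner 0 0]. *)
Proof. by move=> xy0; rewrite innerC xy0 -(inner0l 0) -innerC. Qed.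

(** Pythagoras: the squared norm of [x - y] exceeds that of [x] by [inner y y]. *)
Lemma norm_le_norm_sub_orthogonal x y : inner x y = 0 -> `|x| <= `|x - y|.
Proof.
move=> xy0; rewrite -(ler_pXn2r (n := 2)) ?nnegrE // -!innerE.
rewrite innerBl !innerBr xy0 (inner_sym0 xy0) subr0 sub0r opprK lerDl.
by rewrite innerE exprn_ge0.
Qed.

End InnerProduct.

Lemma g_frame_le_tail (F : numFieldType) (H K : normedModType F)
    (T : H -> H) (L1 : H -> K) :
  g_frame (fun (i : nat) (f : H) => L1 (iter i T f)) ->
  exists A B : F, [/\ 0 < A, A <= B &
    forall f, A * `|f| ^+ 2 <= `|L1 f| ^+ 2 + B * `|T f| ^+ 2].
Proof.
move=> [_ [A [B [A0 AB frame]]]]; exists A, B; split => // f.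
have [s cvgs /andP[As _]] := frame f.
have [t cvgt /andP[_ tB]] := frame (T f).
(* Since [iter i.+1 T f = iter i T (T f)], dropping the first term of the series at [f] leaves the
   series at [T f]. *)
suff st : s = `|L1 f| ^+ 2 + t by rewrite (le_trans As) // st lerD2l.
apply: (cvg_unique (@norm_hausdorff F F^o) cvgs).
rewrite /= -cvg_shiftS.
under eq_fun do
  [rewrite /series/= big_nat_recl//; under eq_bigr do rewrite iterSr].
by apply: cvgD => //; exact: cvg_cst.
Qed.

(** The closure of [S] is compact, so finitely many of the open [r]-balls around all points of [V]
    cover it; the centres need not lie in [S]. *)
Lemma precompact_finite_cover (F : numFieldType) (V : normedModType F)
    (S : set V) (r : F) :
  0 < r -> precompact S ->
  exists ys : seq V, forall x, S x -> exists2 y, y \in ys & `|x - y| < r.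
Proof.
move=> r0; rewrite precompactE compact_cover => Scover.
have [y _|x _|D _ SD] := Scover V setT (fun y => ball y r).
- exact: ball_open.
- by exists x => //; exact: ballxx.
- exists (finmap.enum_fset D) => x /subset_closure /SD[y Dy].
  by rewrite -ball_normE /= distrC; exists y.
Qed.

Lemma exists_unit_vector_orthogonal (F : numFieldType) (theta : F -> F)
    (H K : hilbertType theta) (Hinf : ~ finite_dimensional H)
    (Kfin : finite_dimensional K) (T : H -> H) (L : H -> K) (ys : seq H) :
  linear T -> linear L ->
  exists f : H, [/\ `|f| = 1, L f = 0 &
    forall y, y \in ys -> inner (T f) y = 0].
Proof.
move=> T_lin L_lin; have [m [e e_span]] := Kfin.
(* The required orthogonality relations are the vanishing of one linear map into a
   finite-dimensional space; were it injective, [H] would be finite-dimensional. *)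
pose phi f := row_mx (\row_i inner (L f) (e i))
                     (\row_(j < size ys) inner (T f) ys`_j).
have phi_lin : linear phi.
  move=> a u v; rewrite /phi scale_row_mx add_row_mx T_lin L_lin.
  by congr row_mx; apply/rowP => i; rewrite !mxE innerDl innerZl.
have [f f0 phif0] : exists2 f, f != 0 & phi f = 0.
  apply: contrapT => no_f; apply: Hinf.
  apply: (finite_dimensional_of_linear_inj phi_lin) => x phix0.
  by apply/eqP/negP => /negP x0; apply: no_f; exists x.
have [g g1 phig0] : exists2 g, `|g| = 1 & phi g = 0.
  exists (`|f|^-1 *: f).
    by rewrite normrZ normfV normr_id mulVf // normr_eq0.
  have := phi_lin `|f|^-1 f 0; rewrite addr0 phif0 scaler0 add0r => ->.
  (* It remains that [phi 0 = 0], which is linearity with scalar [-1]. *)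
  by have := phi_lin (-1) 0 0; rewrite scaler0 addr0 scaleN1r addNr.
exists g; split => //.
- have Le i : inner (L g) (e i) = 0.
    by have /rowP/(_ (lshift _ i)) := phig0; rewrite row_mxEl !mxE.
  apply/eqP; rewrite -normr_eq0 -sqrf_eq0 -innerE.
  (* Only the second argument is expanded, so [inner (L g) (L g)] becomes a combination of the
     vanishing [inner (L g) (e i)]. *)
  have [c {2}->] := e_span (L g).
  elim/big_rec: _ => [|i y _ Ly]; first by rewrite inner0r.
  by rewrite innerDr innerZr Le mulr0 add0r.
- move=> y /(nthP 0)[j jys <-].
  by have /rowP/(_ (rshift _ (Ordinal jys))) := phig0; rewrite row_mxEr !mxE.
Qed.

Theorem proposition2p10 (R : realType) (F : numFieldType) (theta : F -> F)
    (hF : hilbert_scalars R theta) (H K : hilbertType theta)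
    (Hsep : separable_space H) (Hinf : ~ finite_dimensional H)
    (Kfin : finite_dimensional K)
    (T : H -> H) (hT : bounded_operator T)
    (L1 : H -> K) (hL1 : bounded_operator L1)
    (hframe : g_frame (fun (i : nat) (f : H) => L1 (iter i T f))) :
  ~ compact_operator T.
Proof.
move=> [_ Tcompact].
have [A [B [A0 AB bound]]] := g_frame_le_tail hframe.
have B0 : 0 < B := lt_le_trans A0 AB.
(* Halving makes [r < A / B] strict, whence [B * r < A]; [A <= B] then gives [r < 1]. *)
pose r := A / B / 2.
have r0 : 0 < r by rewrite !divr_gt0.
have rAB : r < A / B.
  by rewrite ltr_pdivrMr // mulr_natr mulr2n ltrDl divr_gt0.
have BrA : B * r < A by rewrite mulrC -ltr_pdivlMr.
have r1 : r < 1 by rewrite (lt_le_trans rAB) // ler_pdivrMr // mul1r.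
have [ys Tys] := precompact_finite_cover r0 Tcompact.
have [f [f1 Lf0 Tf_orth]] :=
  exists_unit_vector_orthogonal Hinf Kfin ys hT.1 hL1.1.
have [|y yys Tfy] := Tys (T f); first by exists f; rewrite //= f1.
have Tfr : `|T f| < r.
  exact: le_lt_trans (norm_le_norm_sub_orthogonal (Tf_orth _ yys)) Tfy.
have := bound f; rewrite f1 Lf0 normr0 expr0n expr1n mulr1 add0r.
(* As [T f] has norm below [r < 1], its squared norm is at most its norm, so [B] times the square is
   at most [B * r < A]. *)
apply/negP; rewrite lt_geF // (le_lt_trans _ BrA) // ler_pM2l // expr2.
by rewrite (le_trans _ (ltW Tfr)) // ler_piMr // (le_trans (ltW Tfr)) // ltW.
Qed.
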